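(* Assume that $[x^\top,y^\top,z^\top]^\top$ is the unique solution of the double saddle point problem $\mathfrak{B}[x^\top,y^\top,z^\top]^\top=b$ with $D=0$, $E=0$, $b_2=0$, and let $L\in\mathbb{R}^{k\times l}$. Then the partial unified condition number of $[x^\top,y^\top,z^\top]^\top$ with respect to $L$, $$\mathfrak{K}_{\widetilde\varphi}(\widehat{\mathbf{H}},\widehat b;L):=\lim_{\epsilon\to0}\ \sup_{0<\|\mathrm{vec}(\widehat\Psi^\ddagger\odot\Delta\widehat{\mathbf{H}},\,\widehat\chi^\ddagger\odot\Delta\widehat b)\|_\tau\le\epsilon}\frac{\|\xi_L^\ddagger\odot(\widetilde\varphi(\widehat{\mathbf{H}}+\Delta\widehat{\mathbf{H}},\widehat b+\Delta\widehat b)-\widetilde\varphi(\widehat{\mathbf{H}},\widehat b))\|_\gamma}{\|\mathrm{vec}(\widehat\Psi^\ddagger\odot\Delta\widehat{\mathbf{H}},\,\widehat\chi^\ddagger\odot\Delta\widehat b)\|_\tau},$$ is given by $$\mathfrak{K}_{\widetilde\varphi}(\widehat{\mathbf{H}},\widehat b;L)=\left\|\Theta_{\xi_L^\ddagger}L\mathfrak{B}^{-1}\begin{bmatrix}\widehat{\mathcal{G}}&-\widehat I\end{bmatrix}\begin{bmatrix}\Theta_{\mathrm{vec}(\widehat\Psi)} & 0 \\ 0 & \Theta_{\widehat\chi}\end{bmatrix}\right\|_{\tau,\gamma},$$ where $\widehat\Psi=(\Psi_{B^\top},\Psi_C)$, $\Psi_{B^\top}\in\mathbb{R}^{n\times m}$,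 $\Psi_C\in\mathbb{R}^{p\times m}$, $\widehat\chi\in\mathbb{R}^{n+p}$, $\xi_L\in\mathbb R^k$, and $$\widehat{\mathcal{G}}=\begin{bmatrix} y^\top\otimes I_n & 0 \\ I_m\otimes x^\top & I_m\otimes z^\top \\ 0 & y^\top\otimes I_p \end{bmatrix}\in\mathbb{R}^{l\times m(n+p)},\qquad \widehat I=\begin{bmatrix} I_n & 0 \\ 0 & 0 \\ 0 & I_p \end{bmatrix}\in\mathbb{R}^{l\times(n+p)}.$$
   Context: Let $A\in\mathbb{R}^{n\times n}$, $B\in\mathbb{R}^{m\times n}$, $C\in\mathbb{R}^{p\times m}$, $l=n+m+p$, $b=[b_1^\top,b_2^\top,b_3^\top]^\top$ with $b_1\in\mathbb{R}^n$, $b_2\in\mathbb R^m$, $b_3\in\mathbb{R}^p$. The general double saddle point matrix is $\begin{bmatrix} A & B^\top & 0 \\ B & -D & C^\top \\ 0 & C & E \end{bmatrix}$; here $D=0$, $E=0$ and $b_2=0$, so $$\mathfrak{B}=\begin{bmatrix} A & B^\top & 0 \\ B & 0 & C^\top \\ 0 & C & 0 \end{bmatrix},\qquad \mathfrak{B}\begin{bmatrix} x \\ y \\ z \end{bmatrix}=\begin{bmatrix} b_1 \\ 0 \\ b_3 \end{bmatrix},$$ with $\mathfrak{B}$ assumed nonsingular, $x\in\mathbb R^n$, $y\in\mathbb R^m$, $z\in\mathbb R^p$. Only $B$, $C$, $b_1$, $b_3$ are perturbed ($A$, $D$, $E$ and $b_2$ are kept fixed). Put $\widehat{\mathbf{H}}=(B^\top,C)$,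 $\Delta\widehat{\mathbf{H}}=(\Delta B^\top,\Delta C)$, $\widehat b=[b_1^\top,b_3^\top]^\top$, $\Delta\widehat b=[\Delta b_1^\top,\Delta b_3^\top]^\top$, and for $L\in\mathbb{R}^{k\times l}$ $$\widetilde\varphi(\widehat{\mathbf{H}},\widehat b)=L\begin{bmatrix} x \\ y \\ z \end{bmatrix}=L\mathfrak{B}^{-1}\begin{bmatrix} b_1 \\ 0 \\ b_3 \end{bmatrix}.$$ Notation: $\mathrm{vec}$ stacks the columns of a matrix; for a tuple of matrices $\mathrm{vec}(X_1,\dots,X_r)=[\mathrm{vec}(X_1)^\top,\dots,\mathrm{vec}(X_r)^\top]^\top$. $\otimes$ is the Kronecker product and $\odot$ the entrywise product (componentwise on tuples). $\Theta_v$ is the diagonal matrix with diagonal $v$. For a vector or matrix $v$, $v^\ddagger$ has entries $1/v_i$ if $v_i\ne0$ and $1$ if $v_i=0$. $\|\cdot\|_\tau$ and $\|\cdot\|_\gamma$ are vector norms on $\mathbb R^{m(n+p)+n+p}$ and $\mathbb R^k$, and $\|\cdot\|_{\tau,\gamma}$ is the induced matrix norm. In the supremum, perturbations have zero entries wherever the corresponding entry of $\widehat\Psi$, respectively $\widehat\chi$, is zero.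
   Formalization: The formal theorem also assumes that the norm τ does not increase when the entries at zero weights of Ψ̂, χ̂ are set to zero (automatic for nonzero weights or absolute norms); for arbitrary norms with zero weights the formula can fail. *)

(* Defs.v *)
From HB Require Import structures.
From mathcomp Require Import all_boot all_order all_algebra.
From mathcomp Require Import all_classical all_reals all_analysis.
From mathcomp Require Export mxtens.
Import Order.TTheory GRing.Theory Num.Theory.
Import numFieldNormedType.Exports.

Set Implicit Arguments.
Unset Strict Implicit.
Unset Printing Implicit Defensive.

Local Open Scope classical_set_scope.
Local Open Scope ring_scope.

Section Norms.
Variable R : realType.

Record is_vector_norm N (nu : 'cV[R]_N -> R) : Prop := IsVectorNorm {
  vector_norm_triangle : forall v w, nu (v + w) <= nu v + nu w;
  vector_norm_scale : forall a v, nu (a *: v) = `|a| * nu v;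
  vector_norm_eq0 : forall v, nu v = 0 -> v = 0 }.

(* The set is bounded when tau and gamma are norms, and [sup set0 = 0] gives
   the right value when N = 0. *)
Definition induced_norm N k (tau : 'cV[R]_N -> R) (gamma : 'cV[R]_k -> R)
    (M : 'M[R]_(k, N)) : R :=
  sup [set gamma (M *m v) / tau v | v in [set v : 'cV[R]_N | v != 0]].

End Norms.

Section Entrywise.
Variable R : realType.

(* [mxvec] is row-major, hence the transpose: [vec X] stacks the columns. *)
Definition vec r c (X : 'M[R]_(r, c)) : 'cV[R]_(c * r) := (mxvec X^T)^T.

Definition hadamard r c (X Y : 'M[R]_(r, c)) : 'M[R]_(r, c) :=
  map2_mx *%R X Y.

Definition ddagger r c (X : 'M[R]_(r, c)) : 'M[R]_(r, c) :=
  map_mx (fun t => if t == 0 then 1 else t^-1) X.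

Definition vanishes_with r c (X D : 'M[R]_(r, c)) : Prop :=
  forall i j, X i j = 0 -> D i j = 0.

(* The coordinate projection of W onto the positions where X is nonzero.
   Admissible perturbations live in its range, whereas an induced matrix norm
   ranges over the whole space; the two suprema agree when a vector norm is not
   increased by this projection.  That is automatic if X has no zero entry, and
   for any X if the norm is monotone in the absolute values of the entries (as
   all p-norms and weighted p-norms are), but it can fail for other norms. *)
Definition restrict_to r c (X W : 'M[R]_(r, c)) : 'M[R]_(r, c) :=
  \matrix_(i, j) if X i j == 0 then 0 else W i j.

End Entrywise.

Section DoubleSaddlePoint.
Variables (R : realType) (n m p : nat).

Definition dsp_mx (A : 'M[R]_n) (B : 'M[R]_(m, n)) (C : 'M[R]_(p, m)) :
    'M[R]_(n + m + p) :=
  block_mx (block_mx A B^T B 0) (col_mx 0 C^T) (row_mx 0 C) 0.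

(* Pairs such as (B^T, C), their perturbations and their weights. *)
Definition pair_data := ('M[R]_(n, m) * 'M[R]_(p, m))%type.

Definition vec_pair (H : pair_data) : 'cV[R]_(m * n + m * p) :=
  col_mx (vec H.1) (vec H.2).

Definition hadamard_pair (H K : pair_data) : pair_data :=
  (hadamard H.1 K.1, hadamard H.2 K.2).

Definition ddagger_pair (H : pair_data) : pair_data :=
  (ddagger H.1, ddagger H.2).

(* [invmx] is total: it returns its argument on a singular matrix. *)
Definition partial_solution k (L : 'M[R]_(k, n + m + p)) (A : 'M[R]_n)
    (H : pair_data) (b : 'cV[R]_(n + p)) : 'cV[R]_k :=
  L *m invmx (dsp_mx A H.1^T H.2) *m
    col_mx (col_mx (usubmx b) 0) (dsubmx b).

Definition weighted_vec (Psi : pair_data) (chi : 'cV[R]_(n + p))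
    (dH : pair_data) (db : 'cV[R]_(n + p)) :
    'cV[R]_(m * n + m * p + (n + p)) :=
  col_mx (vec_pair (hadamard_pair (ddagger_pair Psi) dH))
         (hadamard (ddagger chi) db).

Section ConditionNumber.
Variables (k : nat) (tau : 'cV[R]_(m * n + m * p + (n + p)) -> R)
  (gamma : 'cV[R]_k -> R) (Psi : pair_data) (chi : 'cV[R]_(n + p))
  (xi : 'cV[R]_k) (L : 'M[R]_(k, n + m + p)) (A : 'M[R]_n)
  (H : pair_data) (b : 'cV[R]_(n + p)).

Definition admissible (eps : R) (d : pair_data * 'cV[R]_(n + p)) : Prop :=
  [/\ vanishes_with Psi.1 d.1.1, vanishes_with Psi.2 d.1.2,
      vanishes_with chi d.2 &
      0 < tau (weighted_vec Psi chi d.1 d.2) <= eps].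

Definition relative_change (d : pair_data * 'cV[R]_(n + p)) : R :=
  gamma (hadamard (ddagger xi)
    (partial_solution L A (H + d.1) (b + d.2) - partial_solution L A H b)) /
  tau (weighted_vec Psi chi d.1 d.2).

(* The supremum is taken in [0, +oo]: adjoining 0 only matters when no
   perturbation is admissible (all weights zero), where the value is 0.
   It may be +oo for large eps, and for such eps the perturbed matrix may also
   be singular; neither happens for all small enough eps if the unperturbed
   matrix is nonsingular, so the limit is not affected. *)
Definition sup_relative_change (eps : R) : \bar R :=
  ereal_sup ([set 0%E] `|`
    [set (relative_change d)%:E | d in admissible eps]).

Definition unified_cond : \bar R := lim (sup_relative_change @ 0^'+).

End ConditionNumber.

Definition G_hat (x : 'cV[R]_n) (y : 'cV[R]_m) (z : 'cV[R]_p) :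
    'M[R]_(n + m + p, m * n + m * p) :=
  let yI q : 'M[R]_(q, m * q) :=
    castmx (mul1n q, erefl) (y^T *t (1%:M : 'M[R]_q)) in
  let Iv q (v : 'cV[R]_q) : 'M[R]_(m, m * q) :=
    castmx (muln1 m, erefl) ((1%:M : 'M[R]_m) *t v^T) in
  col_mx (col_mx (row_mx (yI n) 0)
                 (row_mx (Iv n x) (Iv p z)))
         (row_mx 0 (yI p)).

Definition I_hat : 'M[R]_(n + m + p, n + p) :=
  col_mx (col_mx (row_mx 1%:M 0) 0) (row_mx 0 1%:M).

End DoubleSaddlePoint.

(* Main.v *)
Require Import Defs.
From HB Require Import structures.
From mathcomp Require Import all_boot all_order all_algebra.
From mathcomp Require Import all_classical all_reals all_analysis.
From mathcomp Require Import ring lra.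
Import Order.TTheory GRing.Theory Num.Theory.
Import numFieldNormedType.Exports.
Local Open Scope classical_set_scope.
Local Open Scope ring_scope.

(** The perturbed solution is known exactly.  If X s = b and E, d are the
    perturbations of the matrix and of the right-hand side, then
    (X + E)^-1 (b + d) - s = (X + E)^-1 (d - E s), and E s is linear in the
    perturbed blocks, with matrix [G_hat] ([dsp_mx_mul_G_hat],
    [partial_solution_change]).  So the change is minus
    L (X + E)^-1 [G_hat, - I_hat] v, where v stacks all perturbations, and the
    formula of the theorem is obtained by replacing (X + E)^-1 by X^-1 and by
    writing v as weights times the weighted perturbation w.

    Replacing the inverse costs O(|E| |v|) ([resolvent_estimate]).  All norms on
    a space of column vectors are equivalent ([mx_norm_le_vector_norm]), so this
    is O((tau w)^2), and the quotient in the supremum differs from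
    gamma (M w) / tau w by O(tau w) ([relative_change_first_order]), where M is
    the matrix in the theorem.

    It remains to compare suprema of gamma (M w) / tau w, a quotient unchanged
    by scaling w.  The admissible w are the small vectors that vanish where the
    weights do, whereas the induced norm ranges over all nonzero vectors; but
    M w depends only on the projection of w to the nonzero weights, and this
    projection does not increase tau, so both suprema coincide.  The supremum
    over radius e therefore lies within O(e) of the induced norm
    ([cvg_sup_relative_change]). *)

(** * Norms on real column vectors *)

Section VectorNorms.
Context {R : realType} {N : nat} {nu : 'cV[R]_N -> R}.
Hypothesis Hnu : is_vector_norm nu.

Lemma vector_norm0 : nu 0 = 0.
Proof. by rewrite -(scale0r 0) (vector_norm_scale Hnu) normr0 mul0r. Qed.

Lemma vector_normN v : nu (- v) = nu v.
Proof. by rewrite -scaleN1r (vector_norm_scale Hnu) normrN1 mul1r. Qed.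

Lemma vector_norm_ge0 v : 0 <= nu v.
Proof.
have := vector_norm_triangle Hnu v (- v).
by rewrite subrr vector_norm0 vector_normN -mulr2n pmulrn_lge0.
Qed.

Lemma vector_norm_gt0 v : (0 < nu v) = (v != 0).
Proof.
rewrite lt0r vector_norm_ge0 andbT; congr (~~ _).
by apply/eqP/eqP => [/(vector_norm_eq0 Hnu)//|->]; exact: vector_norm0.
Qed.

Lemma vector_norm_dist v w : `|nu v - nu w| <= nu (v - w).
Proof.
rewrite ler_norml lerBlDr -[in X in _ && (X <= _)](subrK w v).
rewrite (vector_norm_triangle Hnu) andbT lerNl opprB lerBlDr.
rewrite -(vector_normN (v - w)) opprB.
by rewrite -[in X in X <= _](subrK v w) (vector_norm_triangle Hnu).
Qed.

End VectorNorms.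

(** * Equivalence with the maximum norm of the entries *)

Section MatrixNorm.
Context {R : realType}.

Lemma mx_norm_le m n (M : 'M[R]_(m, n)) c :
  0 <= c -> (forall i j, `|M i j| <= c) -> `|M| <= c.
Proof.
move=> c0 Mc; rewrite [leLHS]/Num.norm/= mx_normrE.
by apply/bigmax_leP; split => // -[i j] _; exact: Mc.
Qed.

Lemma mx_norm_entry m n (M : 'M[R]_(m, n)) i j : `|M i j| <= `|M|.
Proof.
rewrite [leRHS]/Num.norm/= mx_normrE.
by apply/bigmax_geP; right; exists (i, j).
Qed.

Lemma mx_normM m n r (M : 'M[R]_(m, n)) (K : 'M[R]_(n, r)) :
  `|M *m K| <= n%:R * `|M| * `|K|.
Proof.
apply: mx_norm_le => [|i j]; first by rewrite !mulr_ge0.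
rewrite mxE (le_trans (ler_norm_sum _ _ _))//.
apply: (@le_trans _ _ (\sum_(h < n) `|M| * `|K|)).
  by apply: ler_sum => h _; rewrite normrM ler_pM// mx_norm_entry.
by rewrite sumr_const card_ord -mulrA mulr_natl.
Qed.

(** The triangle inequality over the coordinates; the [1 +] makes the constant
    positive even in dimension zero. *)
Lemma vector_norm_le_mx_norm N (nu : 'cV[R]_N -> R) :
  is_vector_norm nu -> exists2 c, 0 < c & forall v, nu v <= c * `|v|.
Proof.
move=> Hnu; pose c := \sum_i nu (delta_mx i 0).
have c0 : 0 <= c by apply: sumr_ge0 => i _; exact: vector_norm_ge0.
exists (1 + c) => [|v]; first by rewrite ltr_pwDl.
apply: (@le_trans _ _ (c * `|v|)); last by rewrite ler_wpM2r// lerDr.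
have nu_sum (I : finType) (F : I -> 'cV[R]_N) :
    nu (\sum_i F i) <= \sum_i nu (F i).
  elim/big_rec2: _ => [|i a b _ ab]; first by rewrite (vector_norm0 Hnu).
  by rewrite (le_trans (vector_norm_triangle Hnu _ _))// lerD2l.
rewrite {1}(matrix_sum_delta v) (le_trans (nu_sum _ _))// mulr_suml.
apply: ler_sum => i _; rewrite big_ord1 (vector_norm_scale Hnu) mulrC.
by rewrite ler_wpM2l ?mx_norm_entry// vector_norm_ge0.
Qed.

(** The one place where compactness enters: a norm is continuous, so it has a
    minimum on the unit sphere of the maximum norm; this minimum is positive and
    its inverse is the constant.  The transpositions move the sphere to row
    vectors, the form in which bounded closed sets are known to be compact. *)
Lemma mx_norm_le_vector_norm N (nu : 'cV[R]_N -> R) :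
  is_vector_norm nu -> exists2 c, 0 < c & forall v, `|v| <= c * nu v.
Proof.
move=> Hnu; have [c c0 nuc] := vector_norm_le_mx_norm _ _ Hnu.
pose sphere := [set v : 'rV[R]_N | `|v| = 1].
have norm_tr (v : 'rV[R]_N) : `|v^T| = `|v|.
  apply/le_anti/andP; split; apply: mx_norm_le => // i j.
    by rewrite mxE; exact: mx_norm_entry.
  by have := mx_norm_entry _ _ v^T j i; rewrite mxE.
have norm_trc (v : 'cV[R]_N) : `|v^T| = `|v| by rewrite -norm_tr trmxK.
have nu_cont : continuous (nu \o trmx : 'rV[R]_N -> R).
  move=> v; apply/(@cvgrPdist_le _ _ _ _ (nbhs_filter v)) => e e0.
  have ce0 : 0 < c^-1 * e by rewrite mulr_gt0 ?invr_gt0.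
  apply: (@filterS _ _ (nbhs_filter v) _ _ _ (nbhs_ball_norm v (PosNum ce0))).
  move=> w /= vw; apply: (le_trans (vector_norm_dist Hnu _ _)).
  rewrite -linearB (le_trans (nuc _))// norm_tr -ler_pdivlMl//.
  exact: ltW.
have unit_vec (v : 'cV[R]_N) : v != 0 -> sphere (`|v|^-1 *: v^T).
  move=> v0; rewrite /sphere/= normrZ normfV normr_id norm_trc mulVf//.
  by rewrite normr_eq0.
(* The sphere is empty only if every vector is zero. *)
have [sphere0|/set0P sphere0] := eqVneq sphere set0.
  exists 1 => // v; have [->|/unit_vec] := eqVneq v 0; last by rewrite sphere0.
  by rewrite normr0 mul1r (vector_norm_ge0 Hnu).
have sphere_compact : compact sphere.
  apply: bounded_closed_compact.
    by exists 1; split=> // c' c'1 v v1; rewrite /= v1 ltW.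
  rewrite (_ : sphere = Num.norm @^-1` [set x | x = 1])//.
  apply: preimage_closed; last exact: closed_eq.
  by move=> ? _; exact: norm_continuous.
have [u /set_mem u1 umin] :=
  compact_EVT_min sphere0 sphere_compact (continuous_subspaceT nu_cont).
have nu_u : 0 < nu u^T.
  rewrite (vector_norm_gt0 Hnu) -(inj_eq trmx_inj) trmxK trmx0 -normr_eq0.
  by rewrite u1 oner_eq0.
exists (nu u^T)^-1 => [|v]; first by rewrite invr_gt0.
have [->|v0] := eqVneq v 0.
  by rewrite normr0 mulr_ge0 ?invr_ge0 ?(vector_norm_ge0 Hnu).
have := umin _ (mem_set (unit_vec _ v0)).
rewrite /= linearZ/= trmxK (vector_norm_scale Hnu) normfV normr_id.
by rewrite ler_pdivlMl ?normr_gt0// mulrC ler_pdivlMl// mulrC.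
Qed.

End MatrixNorm.

(** * Kronecker products acting on stacked columns *)

Section VecIndex.

Lemma index_allpairs_pair (S T : eqType) (s : seq S) (t : seq T) x y :
  x \in s -> y \in t ->
  index (x, y) [seq (a, b) | a <- s, b <- t] =
  (index x s * size t + index y t)%N.
Proof.
move=> + yt; elim: s => //= a s IH; rewrite inE index_cat.
have pair_inj (c : S) : injective [eta pair c : T -> S * T] by move=> ? ? [].
have [-> _|nax] := eqVneq x a.
  by rewrite mem_map// yt index_map// ?eqxx mul0n.
move=> /= xs.
rewrite ifN; last by apply/negP => /mapP[b _ [xa _]]; rewrite xa eqxx in nax.
by rewrite size_map IH// mulSn addnA.
Qed.

Lemma val_enum_rank (T : finType) (x : T) :
  enum_rank x = index x (enum T) :> nat.
Proof.
rewrite /enum_rank enum_rank_in.unlock insubdK// -topredE /= cardE index_mem.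
by rewrite mem_enum.
Qed.

(** [mxvec] numbers the entries through the enumeration of pairs, [tensmx]
    through quotient and remainder; both are the row-major order, and this is
    what lets Kronecker products be multiplied with stacked columns. *)
Lemma mxvec_indexE m n (i : 'I_m) (j : 'I_n) :
  mxvec_index i j = mxtens_index (i, j).
Proof.
apply: val_inj; rewrite /= val_enum_rank enumT unlock /= /prod_enum.
by rewrite index_allpairs_pair ?mem_enum// !index_enum_ord size_enum_ord.
Qed.

Lemma vecE (R : realType) r c (X : 'M[R]_(r, c)) i j :
  vec X (mxtens_index (j, i)) 0 = X i j.
Proof. by rewrite -mxvec_indexE /vec mxE mxvecE mxE. Qed.

End VecIndex.

Section KroneckerVec.
Context {R : realType}.

Lemma sum_mxtens_index (m n : nat) (F : 'I_(m * n) -> R) :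
  \sum_h F h = \sum_(i < m) \sum_(j < n) F (mxtens_index (i, j)).
Proof.
rewrite pair_big (reindex (@mxtens_index m n))/=; last first.
  apply: onW_bij; exists (@mxtens_unindex m n); first exact: mxtens_indexK.
  exact: mxtens_unindexK.
by apply: eq_bigr => -[i j] _.
Qed.

(** This and the next lemma are the two instances of the identity
    (Q^T tensor P) vec X = vec (P X Q) that the blocks of [G_hat] need: here P
    is an identity and Q a vector. *)
Lemma kron_trmx_id_vec q m (y : 'cV[R]_m) (X : 'M[R]_(q, m)) :
  castmx (mul1n q, erefl) (y^T *t (1%:M : 'M[R]_q)) *m vec X = X *m y.
Proof.
apply/colP => i; rewrite !mxE sum_mxtens_index; apply: eq_bigr => j _.
rewrite (bigD1 i)//= big1 => [|h hi]; rewrite castmxE/= cast_ord_id vecE.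
  rewrite (_ : cast_ord _ i = mxtens_index (0, i)); last first.
    by apply: val_inj; rewrite /= mul0n.
  by rewrite tensmxE !mxE eqxx mulr1 addr0 mulrC.
rewrite (_ : cast_ord _ i = mxtens_index (0, i)); last first.
  by apply: val_inj; rewrite /= mul0n.
by rewrite tensmxE !mxE eq_sym (negPf hi) mulr0 mul0r.
Qed.

(** Here Q is an identity and P a row, so that P X is a row and vec (P X) is its
    transpose. *)
Lemma kron_id_trmx_vec q m (v : 'cV[R]_q) (X : 'M[R]_(q, m)) :
  castmx (muln1 m, erefl) ((1%:M : 'M[R]_m) *t v^T) *m vec X = X^T *m v.
Proof.
apply/colP => j; rewrite !mxE sum_mxtens_index.
have castE : cast_ord (esym (muln1 m)) j = mxtens_index (j, 0).
  by apply: val_inj; rewrite /= muln1 addn0.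
rewrite (bigD1 j)//= [X in _ + X]big1 ?addr0 => [|h hj].
  apply: eq_bigr => i _; rewrite castmxE/= cast_ord_id castE tensmxE vecE.
  by rewrite !mxE eqxx mul1r mulrC.
apply: big1 => i _; rewrite castmxE/= cast_ord_id castE tensmxE.
by rewrite !mxE eq_sym (negPf hj) !mul0r.
Qed.

End KroneckerVec.

(** * Exact change of the solution *)

Section SaddlePoint.
Context {R : realType} {n m p : nat}.
Notation pair_data := (pair_data R n m p).

Lemma dsp_mxD (A : 'M[R]_n) B C dB (dC : 'M[R]_(p, m)) :
  dsp_mx A (B + dB) (C + dC) = dsp_mx A B C + dsp_mx 0 dB dC.
Proof.
by rewrite /dsp_mx !add_block_mx add_col_mx add_row_mx !linearD/= !addr0.
Qed.

(** The matrix [G_hat] exists for this identity: the product E s is bilinear in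
    the perturbation of the blocks and in the solution s, and [G_hat] expresses
    it as a matrix that depends on s applied to the stacked perturbation. *)
Lemma dsp_mx_mul_G_hat (d : pair_data) x y z :
  dsp_mx 0 d.1^T d.2 *m col_mx (col_mx x y) z = G_hat x y z *m vec_pair d.
Proof.
rewrite /dsp_mx /G_hat /vec_pair !mul_block_col !mul_col_mx !mul_row_col.
rewrite !mul0mx !addr0 !add0r trmxK.
by rewrite !kron_trmx_id_vec !kron_id_trmx_vec add_col_mx addr0.
Qed.

(** All weights, perturbations and weighted perturbations are compared through
    their images in this one coordinate space, where the entrywise operations on
    pairs of matrices become operations on column vectors. *)
Definition flatten_data (d : pair_data * 'cV[R]_(n + p)) :=
  col_mx (vec_pair d.1) d.2.

Lemma I_hatE (b : 'cV[R]_(n + p)) :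
  I_hat R n m p *m b = col_mx (col_mx (usubmx b) 0) (dsubmx b).
Proof.
rewrite -{1}(vsubmxK b) /I_hat !mul_col_mx !mul_row_col.
by rewrite !mul1mx !mul0mx addr0 add0r.
Qed.

(** The first-order formula is exact once the inverse is taken at the perturbed
    matrix: with X s = b, X + E invertible and b changed by d, the difference of
    the solutions is (X + E)^-1 (b + d - (X + E) s) = (X + E)^-1 (d - E s), and
    d - E s is minus the block row of [G_hat] and [- I_hat] applied to the
    perturbation.  Hence only the inverse remains to be approximated. *)
Lemma partial_solution_change k (L : 'M[R]_(k, n + m + p)) (A : 'M[R]_n)
    (B : 'M[R]_(m, n)) (C : 'M[R]_(p, m)) (b : 'cV[R]_(n + p)) x y z d :
  dsp_mx A B C \in unitmx ->
  dsp_mx A B C *m col_mx (col_mx x y) z = I_hat R n m p *m b ->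
  dsp_mx A B C + dsp_mx 0 d.1.1^T d.1.2 \in unitmx ->
  partial_solution L A ((B^T, C) + d.1) (b + d.2) -
  partial_solution L A (B^T, C) b
  = - (L *m (invmx (dsp_mx A B C + dsp_mx 0 d.1.1^T d.1.2) *m
        (row_mx (G_hat x y z) (- I_hat R n m p) *m flatten_data d))).
Proof.
move=> Xu sol XEu.
set s := col_mx _ z in sol.
rewrite /partial_solution /= linearD/= trmxK dsp_mxD -!I_hatE -!mulmxA -mulmxBr.
rewrite (mulmxDr (I_hat R n m p)) -sol mulKmx// -mulmxN; congr (_ *m _).
rewrite mul_row_col mulNmx -dsp_mx_mul_G_hat -/s.
rewrite -[X in _ - X = _](mulKmx XEu s) -mulmxBr -(mulmxN (invmx _)).
rewrite opprB; congr (_ *m _).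
by rewrite mulmxDl opprD addrACA subrr add0r addrC.
Qed.

End SaddlePoint.

(** * Weights and weighted perturbations *)

Section Weights.
Context {R : realType}.

Lemma diag_mx_hadamard r (u v : 'cV[R]_r) : diag_mx u^T *m v = hadamard u v.
Proof. by apply/colP => i; rewrite mul_diag_mx !mxE. Qed.

(** Off the zeros of the weight, multiplying by [ddagger] undoes the weighting;
    at its zeros both sides vanish by assumption. *)
Lemma hadamard_ddaggerK r c (X D : 'M[R]_(r, c)) :
  vanishes_with X D -> hadamard X (hadamard (ddagger X) D) = D.
Proof.
move=> XD; apply/matrixP => i j; rewrite !mxE.
by have [X0|X0] := eqVneq; [rewrite XD// !mulr0|rewrite mulVKf].
Qed.

(** Undoing the weighting of an arbitrary vector loses exactly the coordinates
    of zero weight.  This is where the projection [restrict_to] comes from. *)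
Lemma hadamard_ddagger_hadamard r c (X W : 'M[R]_(r, c)) :
  hadamard (ddagger X) (hadamard X W) = restrict_to X W.
Proof.
apply/matrixP => i j; rewrite !mxE.
by have [->|X0] := eqVneq (X i j) 0; [rewrite mul0r mulr0|rewrite mulKf].
Qed.

Lemma hadamard_restrict r c (X W : 'M[R]_(r, c)) :
  hadamard X (restrict_to X W) = hadamard X W.
Proof.
by apply/matrixP => i j; rewrite !mxE; case: eqVneq => // ->; rewrite !mul0r.
Qed.

Lemma restrict_toZ r c (X W : 'M[R]_(r, c)) a :
  restrict_to X (a *: W) = a *: restrict_to X W.
Proof. by apply/matrixP => i j; rewrite !mxE; case: eqVneq; rewrite ?mulr0. Qed.

Lemma vanishes_with_hadamard r c (X W : 'M[R]_(r, c)) :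
  vanishes_with X (hadamard X W).
Proof. by move=> i j X0; rewrite mxE X0 mul0r. Qed.

Lemma vanishes_with_col_mx r1 r2 c (X1 D1 : 'M[R]_(r1, c))
    (X2 D2 : 'M[R]_(r2, c)) :
  vanishes_with (col_mx X1 X2) (col_mx D1 D2) <->
  vanishes_with X1 D1 /\ vanishes_with X2 D2.
Proof.
split=> [XD|[XD1 XD2] i j].
  split=> i j; first by have := XD (lshift r2 i) j; rewrite !col_mxEu.
  by have := XD (rshift r1 i) j; rewrite !col_mxEd.
by rewrite -(splitK i); case: (fintype.split i) => h /=;
  rewrite ?col_mxEu ?col_mxEd; [exact: XD1|exact: XD2].
Qed.

Lemma vanishes_with_vec r c (X D : 'M[R]_(r, c)) :
  vanishes_with (vec X) (vec D) <-> vanishes_with X D.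
Proof.
split=> XD i j; first by have := XD (mxtens_index (j, i)) 0; rewrite !vecE.
by rewrite ord1; case: (mxtens_indexP i) => h l; rewrite !vecE; exact: XD.
Qed.

Lemma vec_hadamard r c (X Y : 'M[R]_(r, c)) :
  vec (hadamard X Y) = hadamard (vec X) (vec Y).
Proof.
apply/colP => i; case: (mxtens_indexP i) => h l.
by rewrite vecE !mxE -!mxvec_indexE !mxvecE !mxE.
Qed.

Lemma vec_ddagger r c (X : 'M[R]_(r, c)) : vec (ddagger X) = ddagger (vec X).
Proof.
apply/colP => i; case: (mxtens_indexP i) => h l.
by rewrite vecE !mxE -!mxvec_indexE !mxvecE !mxE.
Qed.

Lemma hadamard_col_mx r1 r2 c (X1 Y1 : 'M[R]_(r1, c)) (X2 Y2 : 'M[R]_(r2, c)) :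
  hadamard (col_mx X1 X2) (col_mx Y1 Y2) =
  col_mx (hadamard X1 Y1) (hadamard X2 Y2).
Proof.
by apply/matrixP => i j; rewrite !mxE; case: splitP => h _; rewrite !mxE.
Qed.

Lemma ddagger_col_mx r1 r2 c (X1 : 'M[R]_(r1, c)) (X2 : 'M[R]_(r2, c)) :
  ddagger (col_mx X1 X2) = col_mx (ddagger X1) (ddagger X2).
Proof. exact: map_col_mx. Qed.

End Weights.

Section WeightedData.
Context {R : realType} {n m p : nat}.
Notation data := (pair_data R n m p * 'cV[R]_(n + p))%type.
Implicit Types (Psi : pair_data R n m p) (d : data).

Lemma weighted_vecE Psi (chi : 'cV[R]_(n + p)) d :
  weighted_vec Psi chi d.1 d.2 =
  hadamard (ddagger (flatten_data (Psi, chi))) (flatten_data d).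
Proof.
by rewrite /weighted_vec /flatten_data /vec_pair /= !ddagger_col_mx
  !hadamard_col_mx !vec_hadamard !vec_ddagger.
Qed.

Lemma vanishes_with_flatten Psi (chi : 'cV[R]_(n + p)) d :
  vanishes_with (flatten_data (Psi, chi)) (flatten_data d) <->
  [/\ vanishes_with Psi.1 d.1.1, vanishes_with Psi.2 d.1.2 &
      vanishes_with chi d.2].
Proof.
split=> [/vanishes_with_col_mx[/vanishes_with_col_mx[]]|[? ? ?]].
  by move=> /vanishes_with_vec ? /vanishes_with_vec ?.
apply/vanishes_with_col_mx; split=> //; apply/vanishes_with_col_mx.
by split; exact/vanishes_with_vec.
Qed.

Lemma flatten_data_surj v : exists d, flatten_data d = v.
Proof.
pose unvec q (u : 'cV[R]_(m * q)) : 'M[R]_(q, m) := (vec_mx u^T)^T.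
have unvecK q u : vec (unvec q u) = u by rewrite /vec trmxK vec_mxK trmxK.
exists ((unvec n (usubmx (usubmx v)), unvec p (dsubmx (usubmx v))), dsubmx v).
by rewrite /flatten_data /vec_pair /= !unvecK !vsubmxK.
Qed.

Lemma norm_dsp_mx_le d : `|dsp_mx 0 d.1.1^T d.1.2| <= `|flatten_data d|.
Proof.
have le1 i j : `|d.1.1 i j| <= `|flatten_data d|.
  rewrite -vecE; have := mx_norm_entry _ _ (flatten_data d)
    (lshift _ (lshift _ (mxtens_index (j, i)))) 0.
  by rewrite !col_mxEu.
have le2 i j : `|d.1.2 i j| <= `|flatten_data d|.
  rewrite -vecE; have := mx_norm_entry _ _ (flatten_data d)
    (lshift _ (rshift _ (mxtens_index (j, i)))) 0.
  by rewrite col_mxEu col_mxEd.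
apply: mx_norm_le => // i j; rewrite /dsp_mx.
do ![rewrite mxE; case: splitP => ? _]; rewrite ?mxE ?normr0//.
Qed.

End WeightedData.

(** * Inverses of perturbed matrices *)

Section Resolvent.
Context {R : realType} {l : nat} (X : 'M[R]_l).
Hypothesis Xu : X \in unitmx.

Lemma unitmx_ker0 (Y : 'M[R]_l) :
  (forall v : 'cV[R]_l, Y *m v = 0 -> v = 0) -> Y \in unitmx.
Proof.
move=> Y0; rewrite -unitmx_tr -row_free_unit; apply: inj_row_free => v vY.
apply: trmx_inj; rewrite trmx0; apply: Y0.
by rewrite -[Y]trmxK -trmx_mul vY trmx0.
Qed.

(** Applying X^-1 to (X + E) w gives w + X^-1 E w.  When E is small the
    last term is at most half of w, so (X + E) w = 0 forces w = 0, and the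
    same identity with (X + E) w = v bounds the difference of the two inverses
    at v by X^-1 E w.  A single constant serves as threshold and as bound. *)
Lemma resolvent_estimate : exists2 K, 0 <= K & forall E : 'M[R]_l,
  K * `|E| <= 1 -> X + E \in unitmx /\
  forall v, `|(invmx (X + E) *m v - invmx X *m v : 'cV[R]_l)|
            <= K * `|E| * `|v|.
Proof.
pose Q := invmx X; pose c := l%:R * (l%:R * `|Q|).
have c0 : 0 <= c by rewrite !mulr_ge0.
have QE E (v : 'cV[R]_l) : `|Q *m (E *m v)| <= c * `|E| * `|v|.
  rewrite mulmxA (le_trans (mx_normM _ _ _ _ _))// ler_wpM2r//.
  by rewrite /c -!mulrA ler_wpM2l// mulrA mx_normM.
(* [2 * c] makes X^-1 E at most one half; the last factor bounds X^-1 v by v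
   and is at least 1, so that the threshold persists. *)
exists (2 * c * (1 + l%:R * `|Q|)) => [|E cE].
  by rewrite !mulr_ge0// addr_ge0// mulr_ge0.
have cE2 : c * `|E| <= 2^-1.
  rewrite -(ler_pM2l (ltr0n _ 2)) mulfV// (le_trans _ cE)//.
  rewrite mulrA ler_wpM2r// ler_peMr ?mulr_ge0//.
  by rewrite lerDl mulr_ge0.
have QXE (v : 'cV[R]_l) : Q *m ((X + E) *m v) = v + Q *m (E *m v).
  by rewrite mulmxDl mulmxDr mulKmx.
have bound (v : 'cV[R]_l) : `|v| <= 2 * `|Q *m ((X + E) *m v)|.
  have vE : `|v| <= `|Q *m ((X + E) *m v)| + `|Q *m (E *m v)|.
    by rewrite -[in leLHS](addrK (Q *m (E *m v)) v) -QXE ler_normB.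
  have := le_trans (QE E v) (ler_wpM2r (normr_ge0 v) cE2).
  lra.
have XEu : X + E \in unitmx.
  apply: unitmx_ker0 => v XEv; apply/eqP.
  by rewrite -normr_le0 (le_trans (bound v))// XEv mulmx0 normr0 mulr0.
split=> // v; set w := invmx (X + E) *m v.
have XEw : (X + E) *m w = v by rewrite mulKVmx.
have -> : w - Q *m v = - (Q *m (E *m w)).
  by rewrite -XEw QXE opprD addrA subrr sub0r.
rewrite normrN (le_trans (QE E w))//.
have Qv : `|Q *m v| <= (1 + l%:R * `|Q|) * `|v|.
  by rewrite (le_trans (mx_normM _ _ _ _ _))// ler_wpM2r// lerDr.
have := le_trans (bound w) (ler_wpM2l (ler0n _ 2) _).
rewrite XEw => /(_ _ Qv) wv.
rewrite (le_trans (ler_wpM2l _ wv)) ?mulr_ge0//.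
lra.
Qed.

(** Transfer of the previous estimate to an arbitrary norm of the image under a
    fixed matrix. *)
Lemma first_order_estimate k (P : 'M[R]_(k, l)) (gamma : 'cV[R]_k -> R) :
  is_vector_norm gamma -> exists2 K, 0 <= K & forall E : 'M[R]_l,
  K * `|E| <= 1 -> X + E \in unitmx /\
  forall v, `|gamma (P *m (invmx (X + E) *m v)) - gamma (P *m (invmx X *m v))|
            <= K * `|E| * `|v|.
Proof.
move=> Hgamma; have [K K0 HK] := resolvent_estimate.
have [c c0 gc] := vector_norm_le_mx_norm _ _ Hgamma.
have cP0 : 0 <= c * (l%:R * `|P|) by rewrite !mulr_ge0// ltW.
exists (K * (1 + c * (l%:R * `|P|))) => [|E KE].
  by rewrite mulr_ge0// addr_ge0.
have [|XEu XE] := HK E.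
  rewrite (le_trans _ KE)// ler_wpM2r// ler_peMr//.
  by rewrite lerDl.
split=> // v; rewrite (le_trans (vector_norm_dist Hgamma _ _))// -mulmxBr.
rewrite (le_trans (gc _))//.
rewrite (le_trans (ler_wpM2l (ltW c0) (mx_normM _ _ _ _ _)))//.
rewrite mulrA (le_trans (ler_wpM2l cP0 (XE v)))//.
have : 0 <= K * `|E| * `|v| by rewrite !mulr_ge0.
lra.
Qed.

End Resolvent.

(** * Induced norms *)

Section InducedNorm.
Context {R : realType} {N k : nat}.
Context {tau : 'cV[R]_N -> R} {gamma : 'cV[R]_k -> R}.
Hypotheses (Htau : is_vector_norm tau) (Hgamma : is_vector_norm gamma).

(** The supremum in the definition of the induced norm means what it should only
    if its set is bounded, which is the equivalence of norms on both sides. *)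
Lemma induced_norm_ub (M : 'M[R]_(k, N)) v :
  v != 0 -> gamma (M *m v) / tau v <= induced_norm tau gamma M.
Proof.
move=> v0; apply: ub_le_sup; last by exists v.
have [c c0 gc] := vector_norm_le_mx_norm _ _ Hgamma.
have [d d0 td] := mx_norm_le_vector_norm _ _ Htau.
exists (c * (N%:R * `|M|) * d) => _ [w w0 <-].
rewrite ler_pdivrMr ?(vector_norm_gt0 Htau)// (le_trans (gc _))//.
rewrite (le_trans (ler_wpM2l (ltW c0) (mx_normM _ _ _ _ _)))//.
by rewrite mulrA -[leRHS]mulrA ler_wpM2l// !mulr_ge0// ltW.
Qed.

Lemma induced_norm_ge0 (M : 'M[R]_(k, N)) : 0 <= induced_norm tau gamma M.
Proof.
have [[v v0]|no] := pselect (exists v : 'cV[R]_N, v != 0).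
  apply: le_trans (induced_norm_ub M v v0).
  by rewrite divr_ge0 ?(vector_norm_ge0 Htau) ?(vector_norm_ge0 Hgamma).
rewrite /induced_norm (_ : [set _ | _ in _] = set0) ?sup0//.
by apply/seteqP; split=> // r [v v0 _]; apply: no; exists v.
Qed.

Lemma induced_norm_le (M : 'M[R]_(k, N)) c : 0 <= c ->
  (forall v, v != 0 -> gamma (M *m v) / tau v <= c) ->
  induced_norm tau gamma M <= c.
Proof.
move=> c0 Mc; rewrite /induced_norm; set S := [set _ | _ in _].
have [->|/set0P S0] := eqVneq S set0; first by rewrite sup0.
by apply: ge_sup => // r [v v0 <-]; exact: Mc.
Qed.

End InducedNorm.

(** * The condition number *)

Lemma cvg_at_right_linear_squeeze {R : realType} (f : R -> \bar R)
    (c K e0 : R) :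
  0 < e0 ->
  (forall e, 0 < e -> e <= e0 -> ((c - K * e)%:E <= f e <= (c + K * e)%:E)%E) ->
  f e @[e --> 0^'+] --> c%:E.
Proof.
move=> e00 fc.
have lin (a : R) : (c + a * e)%:E @[e --> 0^'+] --> c%:E.
  apply: cvg_EFin; first exact: nearW.
  apply: cvg_at_right_filter.
  rewrite -[X in _ --> X]addr0 -[X in _ + X](mulr0 a).
  apply: cvgD; first exact: cvg_cst.
  by apply: cvgM; [exact: cvg_cst|exact: cvg_id].
apply: squeeze_cvge (lin (- K)) (lin K).
near=> e; rewrite mulNr; apply: fc.
  by near: e; exact: nbhs_right_gt.
by near: e; exact: nbhs_right_le.
Unshelve. all: by end_near.
Qed.

Section ConditionNumber.
Context {R : realType} {n m p k : nat}.
Local Notation N := (m * n + m * p + (n + p))%N.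
Context {A : 'M[R]_n} {B : 'M[R]_(m, n)} {C : 'M[R]_(p, m)}.
Context {b : 'cV[R]_(n + p)} {x : 'cV[R]_n} {y : 'cV[R]_m} {z : 'cV[R]_p}.
Context {L : 'M[R]_(k, n + m + p)}.
Context {Psi : pair_data R n m p} {chi : 'cV[R]_(n + p)} {xi : 'cV[R]_k}.
Context {tau : 'cV[R]_N -> R} {gamma : 'cV[R]_k -> R}.
Hypotheses (Hunit : dsp_mx A B C \in unitmx)
  (Hsol : dsp_mx A B C *m col_mx (col_mx x y) z = I_hat R n m p *m b)
  (Htau : is_vector_norm tau) (Hgamma : is_vector_norm gamma).

Let psi := flatten_data (Psi, chi).

(** In terms of the weighted perturbation, this is minus the derivative of the
    weighted solution; the sign is immaterial under a norm. *)
Definition condition_mx : 'M[R]_(k, N) :=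
  diag_mx (ddagger xi)^T *m L *m invmx (dsp_mx A B C) *m
  row_mx (G_hat x y z) (- I_hat R n m p) *m
  block_mx (diag_mx (vec_pair Psi)^T) 0 0 (diag_mx chi^T).

(** The value depends on w only through its product with the weights, so it
    ignores the coordinates of w of weight zero. *)
Lemma condition_mxE w :
  condition_mx *m w =
  diag_mx (ddagger xi)^T *m L *m (invmx (dsp_mx A B C) *m
    (row_mx (G_hat x y z) (- I_hat R n m p) *m hadamard psi w)).
Proof.
rewrite /condition_mx -diag_mx_row -tr_col_mx -!mulmxA.
by rewrite -diag_mx_hadamard.
Qed.

(** The exact formula for the change differs from the linear one only in the
    inverse, by O(|E|).  Both E and the vector to which the inverse is applied
    are O(tau w), so the error is O((tau w)^2), and O(tau w) after division by
    tau w. *)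
Lemma relative_change_first_order : exists K e0, [/\ 0 <= K, 0 < e0 &
  forall d, vanishes_with psi (flatten_data d) ->
    0 < tau (weighted_vec Psi chi d.1 d.2) <= e0 ->
  `|relative_change tau gamma Psi chi xi L A (B^T, C) b d -
    gamma (condition_mx *m weighted_vec Psi chi d.1 d.2) /
    tau (weighted_vec Psi chi d.1 d.2)|
  <= K * tau (weighted_vec Psi chi d.1 d.2)].
Proof.
pose U := row_mx (G_hat x y z) (- I_hat R n m p).
have [K K0 HK] := first_order_estimate _ Hunit _
  (diag_mx (ddagger xi)^T *m L) _ Hgamma.
have [c c0 tc] := mx_norm_le_vector_norm _ _ Htau.
pose s := N%:R * `|diag_mx psi^T| * c.
have s0 : 0 <= s by rewrite !mulr_ge0// ltW.
(* [s * tau w] bounds the unweighted perturbation, hence also E. *)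
exists (K * s * (N%:R * `|U| * s)), (1 + K * s)^-1.
have Ks0 : 0 <= K * s by rewrite mulr_ge0.
split=> [||d psid]; first by rewrite !mulr_ge0// ltW.
  by rewrite invr_gt0 (ltr_pwDl ltr01 Ks0).
set w := weighted_vec _ _ _ _ => /andP[w0 we0].
have dw : hadamard psi w = flatten_data d.
  by rewrite /w weighted_vecE hadamard_ddaggerK.
have ds : `|flatten_data d| <= s * tau w.
  rewrite -dw -diag_mx_hadamard (le_trans (mx_normM _ _ _ _ _))//.
  by rewrite -[leRHS]mulrA ler_wpM2l// mulr_ge0.
have Ed : `|dsp_mx 0 d.1.1^T d.1.2| <= s * tau w.
  exact: le_trans (norm_dsp_mx_le d) ds.
have [|XEu est] := HK (dsp_mx 0 d.1.1^T d.1.2).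
  rewrite (le_trans (ler_wpM2l K0 Ed))// mulrA.
  rewrite (le_trans (ler_wpM2l Ks0 we0))// ler_pdivrMr ?ltr_pwDl//.
  by rewrite mul1r lerDr.
rewrite /relative_change -/w -mulrBl normrM normfV [`|tau w|]gtr0_norm//.
rewrite ler_pdivrMr//.
rewrite (partial_solution_change _ _ _ _ _ _ _ _ _ _ Hunit Hsol XEu).
rewrite -diag_mx_hadamard mulmxN (vector_normN Hgamma) mulmxA.
rewrite condition_mxE dw (le_trans (est _))//.
apply: (@le_trans _ _ (K * (s * tau w) * (N%:R * `|U| * (s * tau w)))).
  2: lra.
apply: ler_pM; [by rewrite mulr_ge0|by []|by rewrite ler_wpM2l|].
by rewrite (le_trans (mx_normM _ _ _ _ _))// ler_wpM2l// mulr_ge0.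
Qed.

Hypothesis Hproj : forall w, tau (restrict_to psi w) <= tau w.

(** Both bounds are linear in the radius.  From above, the weighted vector of an
    admissible perturbation competes in the induced norm.  From below, a
    competitor of the induced norm is first projected, which does not change the
    numerator and by assumption does not increase the denominator, and then
    rescaled to the radius, which does not change the quotient; the result is
    the weighted vector of an admissible perturbation. *)
Lemma cvg_sup_relative_change :
  sup_relative_change tau gamma Psi chi xi L A (B^T, C) b e @[e --> 0^'+] -->
  (induced_norm tau gamma condition_mx)%:E.
Proof.
have [K [e0 [K0 e00 HK]]] := relative_change_first_order.
apply: (@cvg_at_right_linear_squeeze _ _ _ K e0 e00) => e e_gt0 ee0.
have Ke0 : 0 <= K * e by rewrite mulr_ge0// ltW.
rewrite /sup_relative_change; set S := _ `|` _; apply/andP; split; last first.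
  apply: ge_ereal_sup => _ [->|[d [d1 d2 d3 /andP[w0 we]] <-]].
    by rewrite lee_fin addr_ge0// (induced_norm_ge0 Htau Hgamma).
  have dpsi : vanishes_with psi (flatten_data d) by exact/vanishes_with_flatten.
  have := HK d dpsi; rewrite w0 (le_trans we ee0) => /(_ isT).
  set w := weighted_vec _ _ _ _ in w0 we *.
  rewrite ler_distl => /andP[_ rw]; rewrite lee_fin (le_trans rw)//.
  rewrite lerD ?ler_wpM2l// (induced_norm_ub Htau Hgamma)//.
  by rewrite -(vector_norm_gt0 Htau).
have S0 : (0 <= ereal_sup S)%E by apply: ereal_sup_ubound; left.
rewrite EFinB leeBlDr//.
case SE : (ereal_sup S) S0 => [r| |]//; last by move=> _; rewrite addye// leey.
rewrite lee_fin => r0; rewrite -EFinD lee_fin.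
apply: (induced_norm_le) => [|v v0]; first by rewrite addr_ge0.
pose v' := restrict_to psi v.
have Mv' : condition_mx *m v = condition_mx *m v'.
  by rewrite !condition_mxE hadamard_restrict.
have [v'0|v'0] := eqVneq v' 0.
  by rewrite Mv' v'0 mulmx0 (vector_norm0 Hgamma) mul0r addr_ge0.
have tv0 : 0 < tau v by rewrite (vector_norm_gt0 Htau).
have tv'0 : 0 < tau v' by rewrite (vector_norm_gt0 Htau).
apply: (@le_trans _ _ (gamma (condition_mx *m v') / tau v')).
  by rewrite Mv' ler_wpM2l ?(vector_norm_ge0 Hgamma)// lef_pV2 ?posrE// Hproj.
(* The factor that puts [v'] on the boundary of the admissible ball. *)
pose t := e / tau v'; have t0 : 0 < t by rewrite divr_gt0.
have [d dE] := flatten_data_surj (hadamard psi (t *: v)).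
have dpsi : vanishes_with psi (flatten_data d).
  by rewrite dE; exact: vanishes_with_hadamard.
have wE : weighted_vec Psi chi d.1 d.2 = t *: v'.
  by rewrite weighted_vecE dE hadamard_ddagger_hadamard restrict_toZ.
have tw : tau (t *: v') = e.
  by rewrite (vector_norm_scale Htau) gtr0_norm// /t divfK// gt_eqF.
have := HK d dpsi; rewrite wE tw e_gt0 ee0 => /(_ isT).
rewrite ler_distl => /andP[+ _]; rewrite lerBlDr.
rewrite -scalemxAr (vector_norm_scale Hgamma) gtr0_norm//.
have -> : t * gamma (condition_mx *m v') / e =
    gamma (condition_mx *m v') / tau v'.
  by rewrite /t; field; rewrite !gt_eqF.
move=> /le_trans; apply; rewrite lerD2r -lee_fin -SE; apply: ereal_sup_ubound.
right; exists d => //; move/vanishes_with_flatten : dpsi => [d1 d2 d3].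
by split=> //; rewrite wE tw e_gt0 lexx.
Qed.

End ConditionNumber.

Theorem theorem6 (R : realType) (n m p k : nat)
    (A : 'M[R]_n) (B : 'M[R]_(m, n)) (C : 'M[R]_(p, m))
    (b1 : 'cV[R]_n) (b3 : 'cV[R]_p)
    (x : 'cV[R]_n) (y : 'cV[R]_m) (z : 'cV[R]_p)
    (L : 'M[R]_(k, n + m + p))
    (PsiBT : 'M[R]_(n, m)) (PsiC : 'M[R]_(p, m))
    (chi : 'cV[R]_(n + p)) (xi : 'cV[R]_k)
    (tau : 'cV[R]_(m * n + m * p + (n + p)) -> R) (gamma : 'cV[R]_k -> R)
    (Hunit : dsp_mx A B C \in unitmx)
    (Hsol : dsp_mx A B C *m col_mx (col_mx x y) z = col_mx (col_mx b1 0) b3)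
    (Htau : is_vector_norm tau) (Hgamma : is_vector_norm gamma)
    (Hproj : forall w,
      tau (restrict_to (col_mx (vec_pair (PsiBT, PsiC)) chi) w) <= tau w) :
  let Psi := (PsiBT, PsiC) in
  let H := (B^T, C) in
  let b := col_mx b1 b3 in
  cvg (sup_relative_change tau gamma Psi chi xi L A H b @ 0^'+) /\
  unified_cond tau gamma Psi chi xi L A H b =
    (induced_norm tau gamma
       (diag_mx (ddagger xi)^T *m L *m invmx (dsp_mx A B C) *m
        row_mx (G_hat x y z) (- I_hat R n m p) *m
        block_mx (diag_mx (vec_pair Psi)^T) 0 0 (diag_mx chi^T)))%:E.
Proof.
move=> Psi H b.
(* The right-hand side in the form in which it is perturbed. *)
have Hsolb : dsp_mx A B C *m col_mx (col_mx x y) z = I_hat R n m p *m b.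
  by rewrite I_hatE col_mxKu col_mxKd.
have cvgK := cvg_sup_relative_change Hunit Hsolb Htau Hgamma Hproj
  (L := L) (xi := xi).
split; first by apply/cvg_ex; eexists; exact: cvgK.
exact: cvg_lim cvgK.
Qed.
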